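(* Let $p=\bigoplus_{i=1}^{m}n_i\delta^{t_i}$ and $p'=\bigoplus_{j=1}^{m'}n'_j\delta^{t'_j}$ be polynomials. The following rule holds: $$p\odot^\flat p'=\begin{cases}\displaystyle\bigoplus_{i=1}^{m}\bigwedge_{j=1}^{m'}\left(n_i\delta^{t_i}\odot^\flat n'_j\delta^{t'_j}\right) & \text{if }t_m\le t'_{m'},\\ \text{undefined} & \text{otherwise,}\end{cases}$$ where undefined intermediate computations are to be ignored (i.e. for each $i$ the $\bigwedge$ is taken only over those $j$ for which $n_i\delta^{t_i}\odot^\flat n'_j\delta^{t'_j}$ is defined).
   Context: Let $\overline{\mathbb Z}=\mathbb Z\cup\{-\infty,+\infty\}$ with its standard order. A counter is a map $s:\overline{\mathbb Z}\to\overline{\mathbb Z}$ that is non-decreasing for the standard order and satisfies $s(-\infty)=-\infty$, $s(+\infty)=+\infty$; $\Sigma$ is the set of counters. Thus a counter is determined by its values on $\mathbb Z$. The order on $\Sigma$ is $s\preceq s'$ iff $s(t)\ge s'(t)$ (standard order, reversed) for all $t\in\mathbb Z$; on $\mathbb Z$, $s\oplus s'$ is the pointwise standard minimum (join for $\preceq$) and $s\wedge s'$ the pointwise standard maximum (meet for $\preceq$). The counter $s_\varepsilon$ is the one equal to $+\infty$ on all of $\mathbb Z$. The Hadamard product of $s_1,s_2\in\Sigma$ is the counter $s_1\odot s_2$ with $(s_1\odot s_2)(t)=s_1(t)+s_2(t)$ for all $t\in\mathbb Z$, where in this sum $(+\infty)+(-\infty)=+\infty$. Dual residual: for $a\in\Sigma$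 let $\mathcal D_a=\{x\in\Sigma : x=s_\varepsilon\text{ if there is }t\in\mathbb Z\text{ with }a(t)=-\infty\}$ and $\mathcal C_a=\{y\in\Sigma : y(t)=+\infty\text{ for all }t\in\mathbb Z\text{ with }a(t)\in\{-\infty,+\infty\}\}$. The map $\mathcal D_a\to\mathcal C_a$, $x\mapsto a\odot x$, is dually residuated; its dual residual is written $y\mapsto y\odot^\flat a$, and for $y\in\mathcal C_a$, $y\odot^\flat a$ is the least (for $\preceq$) counter $x\in\Sigma$ such that $a\odot x\succeq y$. For $y\notin\mathcal C_a$, $y\odot^\flat a$ is not defined. A monomial $n\delta^{t_0}$ (with coefficient $n\in\overline{\mathbb Z}$ and exponent $t_0\in\overline{\mathbb Z}$) denotes the counter with value $n$ at every $t\in\mathbb Z$ with $t\le t_0$ and $+\infty$ at every $t\in\mathbb Z$ with $t>t_0$. A polynomial is a counter written as a finite sum $\bigoplus_{i=1}^{m}n_i\delta^{t_i}$ of monomials, $m\ge1$, with $n_i<n_{i+1}$ and $t_i<t_{i+1}$ (standard order).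
   Formalization: The formal theorem adds that the last coefficient n_m of p is not +∞, and that the first and last coefficients of p' are not −∞ and +∞ respectively; with such infinite coefficients the rule can fail, e.g. p=(+∞)δ^1, p'=0δ^0. *)

(* Defs.v *)
From mathcomp Require Import all_boot all_order all_algebra.
From mathcomp Require Import boolp classical_sets constructive_ereal.

Set Implicit Arguments.
Unset Strict Implicit.
Unset Printing Implicit Defensive.

Import Order.TTheory GRing.Theory Num.Theory.
Import DualAddTheory.
Local Open Scope ereal_scope.
Local Obligation Tactic := idtac.

(* Extended integers are [\bar int]; its canonical order is the standard one. *)

Record counter := Counter {
  counter_fun :> \bar int -> \bar int ;
  counter_mono : {homo counter_fun : x y / x <= y} ;
  counter_Ny : counter_fun -oo = -oo ;
  counter_y : counter_fun +oo = +oo }.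

Lemma counter_ext (s s' : counter) :
  (forall t : int, s t%:E = s' t%:E) -> s = s'.
Proof.
move=> H; have E : counter_fun s = counter_fun s'.
  by apply/funext => -[t||]; rewrite ?counter_Ny ?counter_y ?H.
case: s s' E {H} => f m e1 e2 [g m' e1' e2'] /= E; subst g.
by congr Counter; exact: Prop_irrelevance.
Qed.

(* [cle s s'] is s ≼ s', the reverse of the pointwise standard order. *)
Definition cle (s s' : counter) : Prop := forall t : int, s' t%:E <= s t%:E.

Program Definition cplus (s s' : counter) : counter :=
  @Counter (fun t => mine (s t) (s' t)) _ _ _.
Next Obligation. by move=> s s' x y xy /=; rewrite le_min2 ?counter_mono. Qed.
Next Obligation. by move=> s s' /=; rewrite !counter_Ny minxx. Qed.
Next Obligation. by move=> s s' /=; rewrite !counter_y minxx. Qed.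

Program Definition cmeet (s s' : counter) : counter :=
  @Counter (fun t => maxe (s t) (s' t)) _ _ _.
Next Obligation. by move=> s s' x y xy /=; rewrite le_max2 ?counter_mono. Qed.
Next Obligation. by move=> s s' /=; rewrite !counter_Ny maxxx. Qed.
Next Obligation. by move=> s s' /=; rewrite !counter_y maxxx. Qed.

(* The dual addition [+%dE] is the one for which +oo + -oo = +oo. *)
Program Definition hadamard (s s' : counter) : counter :=
  @Counter (fun t => (s t + s' t)%dE) _ _ _.
Next Obligation. by move=> s s' x y xy /=; rewrite lee_dD ?counter_mono. Qed.
Next Obligation. by move=> s s' /=; rewrite !counter_Ny. Qed.
Next Obligation. by move=> s s' /=; rewrite !counter_y. Qed.

Definition monomial_fun (n t0 t : \bar int) : \bar int :=
  match t with
  | -oo => -oo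
  | +oo => +oo
  | r%:E => if r%:E <= t0 then n else +oo
  end.

Program Definition monomial (n t0 : \bar int) : counter :=
  @Counter (monomial_fun n t0) _ _ _.
Next Obligation.
move=> n t0 [x||] [y||] //=; rewrite ?leey ?leNye// => xy.
by case: (boolP (y%:E <= t0)) => [y0|_]; rewrite ?leey// (le_trans xy y0).
Qed.
Next Obligation. by []. Qed.
Next Obligation. by []. Qed.

(* The least and greatest counters for ≼, i.e. the units of [cplus], [cmeet]. *)
Definition ceps : counter := monomial +oo +oo.
Definition ctop : counter := monomial -oo +oo.

(* The set C_a on which y ↦ y ⊙♭ a is defined. *)
Definition residual_dom (a y : counter) : Prop :=
  forall t : int, a t%:E = -oo \/ a t%:E = +oo -> y t%:E = +oo.

Definition is_dual_residual (y a x : counter) : Prop :=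
  cle y (hadamard a x) /\
  forall x' : counter, cle y (hadamard a x') -> cle x x'.

Lemma ebar_lub (A : set (\bar int)) :
  exists u, (forall x, A x -> x <= u) /\
            (forall v, (forall x, A x -> x <= v) -> u <= v).
Proof.
have [|] := pselect (exists2 z : int, A z%:E & exists k : int, forall x, A x -> x <= k%:E).
  move=> [z Az [k kub]].
  have ex : exists n, `[< A (z + n%:Z)%R%:E >].
    by exists 0%N; apply/asboolP; rewrite addr0.
  have ub n : `[< A (z + n%:Z)%R%:E >] -> (n <= `|k - z|)%N.
    move=> /asboolP /kub; rewrite lee_fin -lerBrDl => h.
    by rewrite -lez_nat gez0_abs// (le_trans _ h).
  have [n /asboolP An nmax] := ex_maxnP ex ub.
  exists (z + n%:Z)%R%:E; split => [x Ax|v /(_ _ An)//].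
  move: x Ax (kub _ Ax) => [x||] Ax // _; rewrite ?leNye// lee_fin.
  have [xz|/ltW zx] := leP x z; first by rewrite (le_trans xz)// lerDl.
  rewrite -lerBlDl -[(x - z)%R]gez0_abs ?subr_ge0// lez_nat nmax//.
  by apply/asboolP; rewrite gez0_abs ?subr_ge0// addrC subrK.
move=> nA; have [noub|] := pselect (forall k : int, exists2 x, A x & k%:E < x).
  exists +oo; split => [x _|[v||] vub]; rewrite ?leey//.
    by have [x /vub xv /lt_geF] := noub v; rewrite xv.
  by have [x /vub xv /lt_geF] := noub 0%R; rewrite (le_trans xv) ?leNye.
move=> /existsNP[k kub].
have {}kub x : A x -> x <= k%:E.
  by move=> Ax; rewrite leNgt; apply/negP => kx; apply: kub; exists x.
exists -oo; split => [x Ax|v _]; last exact: leNye.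
move: x Ax (kub _ Ax) => [x||] // Ax _.
by exfalso; apply: nA; exists x => //; exists k.
Qed.

Lemma dual_residual_exists (y a : counter) :
  residual_dom a y -> exists x, is_dual_residual y a x.
Proof.
move=> yC; pose F x := cle y (hadamard a x).
have Ftop : F ctop.
  move=> t /=; rewrite leey; case E : (a t%:E) => [z||]; rewrite ?leNye//.
  by rewrite yC ?leey//; right.
pose A t : set (\bar int) := fun v => exists2 x : counter, F x & v = x t.
pose f t := projT1 (cid (ebar_lub (A t))).
have fub t (x : counter) : F x -> x t <= f t.
  by move=> Fx; have [+ _] := projT2 (cid (ebar_lub (A t))); apply; exists x.
have flub t v : (forall x, F x -> x t <= v) -> f t <= v.
  move=> h; have [_] := projT2 (cid (ebar_lub (A t))); apply.
  by move=> _ [x Fx ->]; exact: h.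
have fm : {homo f : u v / u <= v}.
  move=> u v uv; apply: flub => x Fx; apply: le_trans (fub v x Fx).
  exact: counter_mono.
have fNy : f -oo = -oo.
  by apply/eqP; rewrite eq_le leNye andbT; apply: flub => x _; rewrite counter_Ny.
have fy : f +oo = +oo.
  by apply/eqP; rewrite eq_le leey -{1}(counter_y ctop); exact: fub.
exists (Counter fm fNy fy); split => [t|x Fx t]; last exact: fub.
rewrite /=; case E : (a t%:E) => [z||].
- have [xz|] := pselect (forall x : counter, F x -> x t%:E <= y t%:E - z%:E).
    have := flub _ _ xz; rewrite leeBrDr//.
    by rewrite dual_addeE_def ?fin_num_adde_defr// addeC.
  move=> /existsNP[x /not_implyP[Fx]]; rewrite leeBrDr// => h; exfalso; apply: h.
  by have := Fx t; rewrite /= E dual_addeE_def ?fin_num_adde_defr// addeC.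
- by rewrite yC ?leey//; right.
- by rewrite yC ?leey//; left.
Qed.

(* [dual_residual y a] is y ⊙♭ a, with [None] for "undefined". *)
Definition dual_residual (y a : counter) : option counter :=
  if pselect (residual_dom a y) is left yC
  then Some (projT1 (cid (dual_residual_exists yC))) else None.

Lemma dual_residualP (y a x : counter) :
  dual_residual y a = Some x <-> residual_dom a y /\ is_dual_residual y a x.
Proof.
rewrite /dual_residual; case: pselect => [yC|nyC]; last by split=> // -[].
case: cid => x0 /= [x0F x0least]; split => [[<-]//|[_ [xF xleast]]].
congr Some; apply: counter_ext => t; apply/eqP.
by rewrite eq_le x0least// xleast.
Qed.

(* Coefficients and exponents are indexed by the nonempty type ['I_m.+1], so that
   [ord0] and [ord_max] are the first and last ones. A summand with coefficient +oo
   is [ceps]; it leaves the counter unchanged but makes the last exponent spurious,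
   so the residual of polynomials has to be computed without such a summand. *)
Definition strictly_increasing (m : nat) (c : 'I_m.+1 -> \bar int) : Prop :=
  forall i j : 'I_m.+1, (i < j)%N -> c i < c j.

Definition polynomial_counter (m : nat) (n t : 'I_m.+1 -> \bar int) : counter :=
  \big[cplus/ceps]_(i < m.+1) monomial (n i) (t i).

(* Undefined members of the family are ignored. *)
Definition meet_defined (m : nat) (s : 'I_m.+1 -> option counter) : counter :=
  \big[cmeet/ctop]_(j < m.+1 | isSome (s j)) odflt ctop (s j).

(* Main.v *)
(** For [t_i <= t'_m'], every constraint that [n_i δ^t_i] imposes on a solution
    [x] of [p' ⊙ x ≽ p] reads [x(s) <= n_i - p'(r)] with [s <= r <= t_i]. Since
    [p'] is non-decreasing, the sharpest one is at [r = t_i] (large [r]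
    if [t_i = +oo]), where [p'(r)] is the coefficient of the first monomial of [p'] whose exponent is at
    least [t_i]. The residual is therefore the sum of the monomials
    [(n_i - n'_J(i)) δ^t_i] with [J(i)] the index of that monomial, and the meet
    over [j] merely selects [J(i)] because [n'] is increasing. *)
Require Import Defs.
From mathcomp Require Import all_boot all_order all_algebra.
From mathcomp Require Import boolp classical_sets constructive_ereal.

Set Implicit Arguments.
Unset Strict Implicit.

Import Order.TTheory GRing.Theory Num.Theory DualAddTheory.
Local Open Scope ereal_scope.

Lemma cplus_bigE (I : finType) (F : I -> counter) (s : int) :
  (\big[cplus/ceps]_i F i) s%:E = \big[mine/+oo]_i F i s%:E.
Proof.
by apply: (big_morph (fun c : counter => c s%:E)) => //=; rewrite leey.
Qed.

Lemma cplus_big_geP (I : finType) (F : I -> counter) (s : int) (v : \bar int) :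
  v <= (\big[cplus/ceps]_i F i) s%:E <-> forall i, v <= F i s%:E.
Proof.
rewrite cplus_bigE; split=> [/bigmin_geP[_ h] i|h]; first exact: h.
by apply/bigmin_geP; split=> //; rewrite leey.
Qed.

Lemma cplus_big_le (I : finType) (F : I -> counter) (s : int) (i : I) :
  (\big[cplus/ceps]_i F i) s%:E <= F i s%:E.
Proof. by move: i; apply/cplus_big_geP. Qed.

Lemma cmeet_big_leP (I : finType) (P : pred I) (F : I -> counter) (s : int)
    (v : \bar int) :
  (\big[cmeet/ctop]_(i | P i) F i) s%:E <= v <-> forall i, P i -> F i s%:E <= v.
Proof.
rewrite (big_morph (fun c : counter => c s%:E) (id1 := -oo) (op1 := maxe))//=;
  last by rewrite leey.
split=> [/bigmax_leP[_ h] i|h]; first exact: h.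
by apply/bigmax_leP; split=> //; rewrite leNye.
Qed.

Lemma monomialE (n t : \bar int) (s : int) :
  monomial n t s%:E = if s%:E <= t then n else +oo.
Proof. by []. Qed.

(** Exponents may be infinite whereas counters are compared at integer times only. A finite [b]
    serves itself; for [b = +oo] one takes [a + 1], or 0 when [a = -oo]. *)
Lemma int_between (a b : \bar int) : a < b -> exists s : int, a < s%:E <= b.
Proof.
case: b => [b||] ab; first by exists b; rewrite ab lexx.
- case: a ab => [a||] // _; last by exists 0%R.
  by exists (a + 1)%R; rewrite leey lte_fin ltrDl ltr01.
- by move: ab; rewrite ltNge leNye.
Qed.

(** For finite [a] the two additions agree, so subtraction residuates the Hadamard product value by
    value. *)
Lemma dadde_le_sub (a x b : \bar int) :
  a \is a fin_num -> ((a + x)%dE <= b) = (x <= b - a).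
Proof.
by move=> afin; rewrite dual_addeE_def ?fin_num_adde_defr// leeBrDl.
Qed.

Lemma strictly_increasing_le (m : nat) (c : 'I_m.+1 -> \bar int) (i j : 'I_m.+1) :
  strictly_increasing c -> (i <= j)%N -> c i <= c j.
Proof.
move=> c_incr; rewrite leq_eqVlt => /predU1P[/val_inj ->//|ij].
exact/ltW/c_incr.
Qed.

(** Makes results on polynomials applicable to monomials. *)
Lemma polynomial_counter1 (a b : \bar int) :
  polynomial_counter (fun _ : 'I_1 => a) (fun _ => b) = monomial a b.
Proof.
apply: counter_ext => s; rewrite /polynomial_counter cplus_bigE.
by rewrite big_ord_recl big_ord0 miney.
Qed.

Section PolynomialResidual.
Variables (m m' : nat) (n t : 'I_m.+1 -> \bar int) (n' t' : 'I_m'.+1 -> \bar int).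
Hypotheses (t_incr : strictly_increasing t)
  (n'_incr : strictly_increasing n') (t'_incr : strictly_increasing t')
  (n_last : n ord_max <> +oo) (n'_fin : forall j, n' j \is a fin_num).

Let p := polynomial_counter n t.
Let p' := polynomial_counter n' t'.

(** At integer times [p'] is never -oo, since its coefficients are finite, and it is +oo exactly
    after [t' ord_max]; likewise [p] is +oo exactly after [t ord_max], because [n ord_max] is not
    +oo. *)
Lemma residual_dom_polynomial :
  residual_dom p' p <-> t ord_max <= t' ord_max.
Proof.
have le_last k (c : 'I_k.+1 -> \bar int) i : strictly_increasing c ->
    c i <= c ord_max.
  by move=> c_incr; rewrite strictly_increasing_le// -ltnS.
split=> [dom|tt' s].
  rewrite leNgt; apply/negP => /int_between[s /andP[t's st]].
  have p's : p' s%:E = +oo.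
    apply/eqP; rewrite eq_le leey; apply/cplus_big_geP => j.
    by rewrite monomialE [s%:E <= _]leNgt (le_lt_trans (le_last _ _ _ t'_incr) t's).
  have : p s%:E <= monomial (n ord_max) (t ord_max) s%:E by exact: cplus_big_le.
  by rewrite (dom s (or_intror p's)) monomialE st leye_eq => /eqP.
have p'Ny : p' s%:E <> -oo.
  move=> p's; have : n' ord0 <= p' s%:E.
    apply/cplus_big_geP => j; rewrite monomialE; case: ifP => _; last exact: leey.
    exact: strictly_increasing_le.
  by rewrite p's leeNy_eq => /eqP n'0; have := n'_fin ord0; rewrite n'0.
case=> // p's; apply/eqP; rewrite eq_le leey; apply/cplus_big_geP => i.
rewrite monomialE; case: ifP => // sti.
have : p' s%:E <= monomial (n' ord_max) (t' ord_max) s%:E by exact: cplus_big_le.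
rewrite p's monomialE (le_trans (le_trans sti (le_last _ _ i t_incr)) tt').
rewrite leye_eq => /eqP n'y.
by have := n'_fin ord_max; rewrite n'y.
Qed.

Variable J : 'I_m.+1 -> 'I_m'.+1.
Hypotheses (t_le_J : forall i, t i <= t' (J i))
  (J_min : forall i j, t i <= t' j -> (J i <= j)%N).

(** [J] stays abstract so that it can be an arg min for polynomials and the identity of ['I_1] for
    monomials. *)
Lemma polynomial_residual :
  dual_residual p p' =
  Some (\big[cplus/ceps]_(i < m.+1) monomial (n i - n' (J i)) (t i)).
Proof.
apply/dual_residualP; split; first apply/residual_dom_polynomial.
  by rewrite (le_trans (t_le_J _))// strictly_increasing_le// -ltnS.
split=> [s|x' solx' s].
  apply/cplus_big_geP => i; rewrite monomialE; case: ifP => sti; last exact: leey.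
  (* From [s <= t i <= t' (J i)] the summand [J i] of [p'] is active at [s], which bounds [p' s] by
     [n' (J i)]. *)
  apply: (@le_trans _ _ (n' (J i) + (n i - n' (J i))%E)%dE); last by rewrite dadde_le_sub.
  apply: lee_dD.
    apply: le_trans (cplus_big_le _ s (J i)) _.
    by rewrite monomialE (le_trans sti).
  by apply: le_trans (cplus_big_le _ s i) _; rewrite monomialE sti.
apply/cplus_big_geP => i; rewrite monomialE; case: ifP => sti; last exact: leey.
(* The sharpest constraint is read at an integer [r] in [[s, t i]] beyond every exponent of [p']
   below [t i]: the summands of [p'] still active at [r] have index at least [J i]. *)
have [r [sr rti r_sep]] : exists r : int, [/\ (s <= r)%R, r%:E <= t i &
    forall j, r%:E <= t' j -> t i <= t' j].
  (* The default -oo of an empty maximum also lies below [t i], which is at least the integer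
     [s]. *)
  have : \big[maxe/-oo]_(j | t' j < t i) t' j < t i.
    by apply/bigmax_ltP; split=> //; apply: lt_le_trans sti; rewrite ltNyr.
  move=> /int_between[r /andP[Mr rti]].
  exists (Num.max s r); split; first by rewrite le_max lexx.
    by rewrite EFin_max ge_max sti.
  move=> j; rewrite EFin_max ge_max => /andP[_ rt'j].
  rewrite leNgt; apply/negP => t'jti; move: rt'j; apply/negP; rewrite -ltNge.
  by move: Mr => /bigmax_ltP[_]; apply.
(* The choice of [r] gives [n' (J i) <= p' r], and [x' s <= x' r] by monotonicity. *)
rewrite -dadde_le_sub//; apply: (@le_trans _ _ (p' r%:E + x' r%:E)%dE).
  apply: lee_dD; last by rewrite counter_mono ?lee_fin.
  apply/cplus_big_geP => j; rewrite monomialE; case: ifP => rt'j; last exact: leey.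
  by rewrite strictly_increasing_le// J_min// r_sep.
apply: le_trans (solx' r) _; apply: le_trans (cplus_big_le _ r i) _.
by rewrite monomialE rti.
Qed.

End PolynomialResidual.

Lemma monomial_residual (n t n' t' : \bar int) :
  n <> +oo -> n' \is a fin_num ->
  dual_residual (monomial n t) (monomial n' t') =
  if t <= t' then Some (monomial (n - n') t) else None.
Proof.
move=> ny n'fin.
have incr1 (c : \bar int) : strictly_increasing (fun _ : 'I_1 => c).
  by move=> i j; rewrite !ord1.
rewrite -!polynomial_counter1; case: ifP => tt'.
  by rewrite (polynomial_residual _ _ _ _ _ (J := id))// => i j _; rewrite !ord1.
case E: dual_residual => [x|]//; move/dual_residualP: E => [+ _].
by move/residual_dom_polynomial => /= /(_ (incr1 _) (incr1 _) (incr1 _) ny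
  (fun=> n'fin)); rewrite tt'.
Qed.

(** The defined members share the exponent [t], and [n - n' j] does not increase with [j], so the
    pointwise maximum is attained at the least admissible index. *)
Lemma meet_defined_monomial (m' : nat) (n t : \bar int)
    (n' t' : 'I_m'.+1 -> \bar int) (J : 'I_m'.+1) :
  strictly_increasing n' -> (forall j, n' j \is a fin_num) -> n <> +oo ->
  t <= t' J -> (forall j, t <= t' j -> (J <= j)%N) ->
  meet_defined (fun j => dual_residual (monomial n t) (monomial (n' j) (t' j))) =
  monomial (n - n' J) t.
Proof.
move=> n'_incr n'_fin ny tJ J_min; rewrite /meet_defined.
rewrite (eq_bigl (fun j => t <= t' j)); last first.
  by move=> j; rewrite monomial_residual//; case: ifP.
rewrite (eq_bigr (fun j => monomial (n - n' j) t)); last first.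
  by move=> j tj; rewrite monomial_residual// tj.
apply: counter_ext => s; apply/eqP; rewrite eq_le; apply/andP; split.
  apply/cmeet_big_leP => j /J_min Jj; rewrite !monomialE; case: ifP => // _.
  by rewrite leeB// strictly_increasing_le.
by have /cmeet_big_leP -/(_ J tJ) := lexx
  ((\big[cmeet/ctop]_(j | t <= t' j) monomial (n - n' j) t) s%:E).
Qed.

Unset Implicit Arguments.

Theorem proposition3p11 (m m' : nat)
  (n t : 'I_m.+1 -> \bar int) (n' t' : 'I_m'.+1 -> \bar int)
  (n_incr : strictly_increasing n) (t_incr : strictly_increasing t)
  (n'_incr : strictly_increasing n') (t'_incr : strictly_increasing t')
  (n_last : n ord_max <> +oo)
  (n'_first : n' ord0 <> -oo) (n'_last : n' ord_max <> +oo) :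
  dual_residual (polynomial_counter n t) (polynomial_counter n' t') =
  if t ord_max <= t' ord_max then
    Some (\big[cplus/ceps]_(i < m.+1)
            meet_defined (fun j : 'I_m'.+1 =>
              dual_residual (monomial (n i) (t i)) (monomial (n' j) (t' j))))
  else None.
Proof.
have n'_fin j : n' j \is a fin_num.
  have := @strictly_increasing_le _ n' ord0 j n'_incr (leq0n j).
  have := @strictly_increasing_le _ n' j ord_max n'_incr (leq_ord _).
  case: (n' j) => // [+ _|_]; first by rewrite leye_eq => /eqP.
  by rewrite leeNy_eq => /eqP.
case: ifP => tt'; last first.
  case E: dual_residual => [x|]//; move/dual_residualP: E => [+ _].
  by move/(residual_dom_polynomial t_incr n'_incr t'_incr n_last n'_fin); rewrite tt'.
have ny i : n i <> +oo.
  move=> niy; have := strictly_increasing_le n_incr (leq_ord i : (i <= ord_max)%N).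
  by rewrite niy leye_eq => /eqP.
have t_last i : t i <= t' ord_max.
  exact: le_trans (strictly_increasing_le t_incr (leq_ord i : (i <= ord_max)%N)) tt'.
(* The comparison of last exponents makes [ord_max] an admissible index for every [i], so the
   minimum exists. *)
pose J i := [arg min_(j < ord_max | t i <= t' j) (j : nat)].
have J_spec i : t i <= t' (J i) /\ forall j, t i <= t' j -> (J i <= j)%N.
  by rewrite /J; case: arg_minnP.
rewrite (polynomial_residual _ _ _ _ _ (J := J))//;
  try by move=> i; case: (J_spec i).
congr Some; apply: eq_bigr => i _; have [tJ J_min] := J_spec i.
by rewrite (meet_defined_monomial (J := J i)).
Qed.
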